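(* Let $m=2k$ with $k\ge 3$, and let $u\in\mathcal S$, that is, $u=u_0\cdots u_{m-1}$ is a binary string of length $m$ with $u_{i+k}\ne u_i$ for all $0\le i\le k-1$. If $a$ is the arc of the Walecki tournament $W_u$ between the vertices $0$ and $m$, then $d(a)=1$. In particular, every automorphism of $W_u$ fixes $*$. Moreover, if $W_v$ is a Walecki tournament with $W_u\cong W_v$, then any isomorphism from $W_u$ to $W_v$ must map the vertex labelled $*$ in $W_u$ to the vertex labelled $*$ in $W_v$.
   Context: Let $m\ge 1$ be an integer and $n=2m$. The vertex set is $\mathbb Z_n\cup\{*\}$ ($2m+1$ vertices). Let $C_0^+$ be the directed Hamilton cycle $*\to 0\to 1\to -1\to 2\to -2\to\cdots\to m\to *$. For $j\in\mathbb Z_n$, $C_j^+$ is the image of $C_0^+$ under the permutation fixing $*$ and sending $x\mapsto x+j$ on $\mathbb Z_n$, and $C_j^-$ is $C_j^+$ with all arcs reversed. The undirected Hamilton cycles underlying $C_0^+,\dots,C_{m-1}^+$ decompose the edges of the complete graph. For a binary string $u=u_0u_1\cdots u_{m-1}\in\{0,1\}^m$ (the signature), the Walecki tournament $W_u$ consists, for each $0\le j\le m-1$, of the arcs of $C_j^+$ if $u_j=1$ and of the arcs of $C_j^-$ if $u_j=0$. For an arc $a$, $d(a)$ denotes the number of directed triangles (directed cycles of length $3$) containing $a$. For $m=2k$, $\mathcal S$ denotes the set of binary strings $u=u_0\cdots u_{m-1}$ with $u_{i+k}\neq u_i$ for $0\le i\le k-1$. *)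

(* Defs.v *)
From HB Require Import structures.
From mathcomp Require Import all_boot all_order all_algebra.
Set Implicit Arguments.
Unset Strict Implicit.
Unset Printing Implicit Defensive.
Import GRing.Theory.
Local Open Scope ring_scope.

(* A digraph on a finite vertex type V is given by its set of arcs. *)
Definition digraph (V : finType) := {set V * V}.

Definition reverse (V : finType) (A : digraph V) : digraph V :=
  [set (a.2, a.1) | a in A].

(* Intended for duplicate-free s, the vertices of a directed cycle in order. *)
Definition cycle_arcs (V : finType) (s : seq V) : digraph V :=
  [set (x, next s x) | x in s].

(* A directed triangle is identified with its set of arcs, so that the three
   rotations of its vertex sequence are counted once. *)
Definition triangles (V : finType) (A : digraph V) : {set digraph V} :=
  [set cycle_arcs (val s) | s : 3.-tuple V & ucycleb [rel x y | (x, y) \in A] s].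

Definition triangle_degree (V : finType) (A : digraph V) (a : V * V) : nat :=
  #|[set t in triangles A | a \in t]|.

Definition digraph_iso (V V' : finType) (A : digraph V) (B : digraph V')
    (f : V -> V') : Prop :=
  bijective f /\ forall x y : V, ((f x, f y) \in B) = ((x, y) \in A).

Definition arc_between (V : finType) (A : digraph V) (x y : V) (a : V * V) :
    Prop :=
  a \in A /\ (a = (x, y) \/ a = (y, x)).

(* None is the vertex *; 'Z_(2 * m) is the ring Z/2m only for 0 < m. *)
Definition vertex (m : nat) : finType := option 'Z_(2 * m).

Definition star (m : nat) : vertex m := None.

Definition lab (m i : nat) : vertex m := Some i%:R.

(* *, 0, 1, -1, 2, -2, ..., m-1, -(m-1), m *)
Definition hamilton0 (m : nat) : seq (vertex m) :=
  star m :: lab m 0 ::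
    flatten [seq [:: Some i%:R; Some (- i%:R)] | i <- iota 1 m.-1]
    ++ [:: lab m m].

Definition shift (m : nat) (j : 'Z_(2 * m)) (x : vertex m) : vertex m :=
  omap (fun i => i + j) x.

Definition hamilton_pos (m : nat) (j : 'Z_(2 * m)) : digraph (vertex m) :=
  cycle_arcs [seq shift j x | x <- hamilton0 m].

Definition hamilton_neg (m : nat) (j : 'Z_(2 * m)) : digraph (vertex m) :=
  reverse (hamilton_pos j).

Definition walecki (m : nat) (u : m.-tuple bool) : digraph (vertex m) :=
  \bigcup_(j < m)
    (if tnth u j then hamilton_pos j%:R else hamilton_neg j%:R).

Definition antipodal_signatures (k : nat) : {set (2 * k).-tuple bool} :=
  [set u : (2 * k).-tuple bool |
    [forall i : 'I_k, nth false u (i + k) != nth false u i]].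

(* Main.v *)
Require Import Defs.
From mathcomp Require Import all_boot all_order all_algebra.
From mathcomp Require Import zify ring.

Set Implicit Arguments.
Unset Strict Implicit.
Unset Printing Implicit Defensive.
Import GRing.Theory.

(** Extend the signature of a Walecki tournament on [2 m + 1] vertices to a
    sequence [V] on the naturals with [V (t + m) = ~~ V t]. The arc between [b]
    and [b + d], for [0 < d < 2 m], leaves [b] exactly when
    [V (b + d./2) (+) ~~ odd d], and [*] dominates [b] exactly when [V b]
    ([walecki_rel_step], [waleckiE]); rotating the tournament shifts [V].

    Call [x] and [y] almost twins with exception [z] when every vertex other
    than [x], [y], [z] is dominated by both or by neither. If [V] comes from an
    antipodal signature, then 0 and [m = 2 k] are almost twins with exception
    [*] ([antipodal_almost_twins]). As [*] does close a triangle on the arc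
    between them, and any third vertex of such a triangle separates its ends,
    the arc lies in exactly one triangle.

    Almost twins are preserved by isomorphisms, so it remains to locate them in
    an arbitrary Walecki tournament with [m = 2 k] and [k > 2].
    - The vertex [*] has no almost twin ([star_not_almost_twin]): the
      constraints say, up to one failure, that [V (2 t) = ~~ V t] and
      [V (2 t + 1) = V t] for all relevant [t], and combined with the
      antiperiodicity they are contradictory.
    - Suppose [b] and [b + d], with [0 < d <= m], are almost twins with an
      exception other than [*] ([almost_twins_labels]). For even [d] a parity
      count of the disagreements gives a contradiction. For odd [d] the
      constraints force [V] to be constant on [b], ..., [b + m - 1], with
      [d = m - 1] and exception [b + m].
    - In that last case the exception [b + m] itself has the almost twin
      [b + 2 m - 1] ([constant_almost_twins]).
    Hence an isomorphism from the antipodal tournament that moved [*] would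
    send it to a vertex with an almost twin, and its inverse would give an
    almost twin of [*]. *)

(** * Antiperiodic bit sequences *)

(** Moving by [m] flips the bit; in particular [V] has period [2 * m]. *)
Definition antiperiodic (m : nat) (V : nat -> bool) : Prop :=
  forall t, V (t + m) = ~~ V t.

Lemma antiperiodic_shift m V b :
  antiperiodic m V -> antiperiodic m (fun t => V (b + t)).
Proof. by move=> hV t; rewrite addnA hV. Qed.

Lemma antiperiodic_add2m m V t :
  antiperiodic m V -> V (t + 2 * m) = V t.
Proof. by move=> hV; rewrite mul2n -addnn addnA !hV negbK. Qed.

Lemma antiperiodic_mod m V t :
  antiperiodic m V -> V (t %% (2 * m)) = V t.
Proof.
move=> hV; rewrite {2}(divn_eq t (2 * m)) addnC.
elim: (_ %/ _) => [|q IH]; first by rewrite mul0n addn0.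
by rewrite (mulSn q) addnCA addnC antiperiodic_add2m.
Qed.

Lemma antiperiodic_window m V e :
  antiperiodic m V ->
  \big[addb/false]_(t < m) V (t + e) = \big[addb/false]_(t < m) V t (+) odd e.
Proof.
move=> hV; elim: e => [|e IH].
  by rewrite addbF; apply: eq_bigr => t _; rewrite addn0.
have := @big_ord_recl _ false addb m (fun t => V (t + e)).
rewrite big_ord_recr /= addnC hV IH => E.
rewrite (eq_bigr (fun t : 'I_m => V (bump 0 t + e))); last first.
  by move=> t _; rewrite /bump leq0n add1n addSnnS.
by move: E; rewrite add0n; do 2![case: (\big[_/_]_(_ < _) _)]; case: (V e); case: odd.
Qed.

Lemma odd_initial_segment m e :
  e <= m -> \big[addb/false]_(t < m) (t < e) = odd e.
Proof.
elim: m e => [|m IH] [|e] // le_em; [exact: big_ord0 | exact: big1 | ].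
rewrite big_ord_recl /= -(IH e) //.
Qed.

(** The bit [V t (+) V (t + e) (+) (t < e)] tells whether the vertices 0 and
    [2 * e] disagree on [2 * t] and on [2 * t + 1], whenever these are other
    vertices; the number of such [t] below [m] is even. *)
Lemma even_defect m V e : antiperiodic m V -> e <= m ->
  \big[addb/false]_(t < m) (V t (+) V (t + e) (+) (t < e)) = false.
Proof.
move=> hV le_em; rewrite !big_split /= antiperiodic_window // odd_initial_segment //.
by rewrite addbA addbb; case: odd.
Qed.

(** The vertices 0 and [2 * e] disagree on a set of [t] of even size. If they
    agree on [*], that is [V 0 = V (2 * e)], then exactly one of [0] and [e] is
    in this set, so some other [t] is. *)
Lemma no_even_twins m V e : antiperiodic m V -> 0 < e < m ->
  V 0 = V (2 * e) ->
  (forall t, 0 < t < m -> t != e -> V t (+) V (t + e) (+) (t < e) = false) ->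
  False.
Proof.
move=> hV /andP[e_gt0 lt_em] V0 hd.
have m_gt0 : 0 < m by lia.
have := even_defect hV (ltnW lt_em).
rewrite (bigD1 (Ordinal m_gt0)) //= (bigD1 (Ordinal lt_em)) /=; last first.
  by rewrite -val_eqE /=; lia.
rewrite big1 => [|t /andP[/negbTE t0 te]].
  by rewrite add0n e_gt0 ltnn addnn -mul2n V0; case: (V e); case: (V _).
by apply: hd => //; move: t0; rewrite -val_eqE /=; have := ltn_ord t; lia.
Qed.

(** The vertices 0 and [2 * e + 1], with exceptional vertex [w]. The last two
    hypotheses express agreement on the even vertices [2 * t] and on the odd
    vertices [2 * t + 1]. Comparing them at consecutive places shows that [V] is
    locally constant away from [e] and [w]. *)
Lemma odd_twins k V e w : antiperiodic (2 * k) V -> 1 < k -> e < k ->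
  V 0 = V (2 * e).+1 ->
  (forall t, 0 < t < 2 * k -> 2 * t != w -> V t (+) V (t + e) (+) (t <= e)) ->
  (forall t, t < 2 * k -> t != e -> (2 * t).+1 != w ->
     V t (+) V (t + e).+1 (+) (t < e)) ->
  [/\ k = e.+1, w = 2 * k & forall t, t < 2 * k -> V t = V 0].
Proof.
move=> hV k_gt1 lt_ek V0 hA hB.
have step t : t.+1 < 2 * k -> t != e -> (2 * t).+1 != w -> (2 * t.+1) != w ->
    V t.+1 = V t.
  move=> lt_t te w1 w2; have := hA t.+1; have := hB t.
  rewrite addSn => /(_ ltac:(lia) te w1) B1 /(_ ltac:(lia) w2).
  by move: B1; do 3![case: (V _)]; case: (t < e).
have [w_eq|w_neq] := eqVneq w (2 * e.+1); last first.
  (* Then [V (e + 1)] differs from [V (2 e + 1) = V 0]. For [e > 0] this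
     violates the constraint at the vertex 1, so [w = 1] and [V] is constant
     from [e + 1] to [2 e + 1], a contradiction. *)
  exfalso.
  have A1 : V e.+1 = ~~ V 0.
    have := hA e.+1 ltac:(lia) ltac:(lia); rewrite ltnn V0.
    by rewrite (_ : (2 * e).+1 = e.+1 + e); [case: (V _); case: (V _)|lia].
  case: e => [|e] in lt_ek V0 hA hB step w_neq A1 *.
    have H t : 0 < t < 2 * k -> 2 * t != w -> False.
      move=> t_in tw; have := hA t t_in tw; rewrite addn0 addbb leqn0.
      by case: t t_in tw.
    by have [E|/H] := eqVneq (2 * 1) w; [apply: (H 2)|]; lia.
  have [w1|w1] := eqVneq 1 w; last first.
    by have := hB 0 ltac:(lia) ltac:(lia) w1; rewrite A1; case: (V 0).
  have const t : t <= e.+1 -> V (e.+2 + t) = V e.+2.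
    elim: t => [|t IH] le_t; first by rewrite addn0.
    by rewrite addnS step ?IH //; lia.
  have := const e.+1 (leqnn _); rewrite (_ : _ + _ = (2 * e.+1).+1); last by lia.
  by rewrite A1 -V0; case: (V 0).
have low t : t <= e -> V t = V 0.
  elim: t => // t IH le_t; rewrite step ?IH //; lia.
have mid : V e.+1 = V 0.
  case: e => [|e] in lt_ek V0 hA hB step low w_eq *; first by rewrite V0.
  by have := hB 0 ltac:(lia) ltac:(lia) ltac:(lia); do 2![case: (V _)].
have high t : e.+1 + t < 2 * k -> V (e.+1 + t) = V 0.
  elim: t => [|t IH] lt_t; first by rewrite addn0.
  by rewrite addnS step ?IH //; lia.
have all t : t < 2 * k -> V t = V 0.
  move=> lt_t; have [/low //|lt_et] := leqP t e.
  by rewrite -(subnKC lt_et) high ?subnKC.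
have k_eq : k = e.+1.
  apply/eqP/negPn/negP => k_neq.
  have := hA e.+2 ltac:(lia) ltac:(lia).
  by rewrite (all e.+2) ?(all (e.+2 + e)) ?addbb; lia.
by split=> //; rewrite k_eq.
Qed.

(** Conversely, if [V] is constant below [2 * k.+1], then all constraints for
    the vertices 0 and [2 * k + 1] hold except the one at [2 * k.+1]. *)
Lemma constant_odd_twins k V t : antiperiodic (2 * k.+1) V ->
  (forall i, i < 2 * k.+1 -> V i = V 0) ->
  t < 2 * k.+1 ->
  (t != k.+1 -> 0 < t -> V t (+) V (t + k) (+) (t <= k)) /\
  (t != k -> V t (+) V (t + k).+1 (+) (t < k)).
Proof.
move=> hV hc lt_t; split=> [t1 t_gt0|t1].
  rewrite (hc t) //; have [le_tk|lt_kt] := leqP t k.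
    by rewrite hc ?addbb //; lia.
  rewrite (_ : t + k = (t - k.+2) + 2 * k.+1); last by lia.
  by rewrite hV hc ?addbN ?addbb //; lia.
rewrite (hc t) //; have [lt_tk|le_kt] := ltnP t k.
  by rewrite hc ?addbb //; lia.
rewrite (_ : (t + k).+1 = (t - k.+1) + 2 * k.+1); last by lia.
by rewrite hV hc ?addbN ?addbb //; lia.
Qed.

(** For [k > 3] the contradiction comes from the indices [k + 3] and [k + 4],
    which are [2 * i] and [2 * i + 1] for the same [i]. *)
Lemma no_doubling_sequence k V : 2 < k -> odd k ->
  (forall t, 0 < t < k -> V (2 * t) = ~~ V t) ->
  (forall t, 0 < t < k -> V (2 * t).+1 = V t) ->
  (forall t, 0 < t < k -> V (t + k) = ~~ V t) -> False.
Proof.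
move=> k_gt2 odd_k hD hE hk.
have V2 := hD 1 ltac:(lia); have V4 := hD 2 ltac:(lia).
have [k3|k_neq3] := eqVneq k 3.
  have := hk 1 ltac:(lia); rewrite k3 (_ : 1 + 3 = 2 * 2) // V4 V2.
  by case: (V 1).
have V3 := hE 1 ltac:(lia).
have := hk 3 ltac:(lia); have := hk 4 ltac:(lia).
rewrite (_ : 4 + k = (2 * (k./2 + 2)).+1); last by lia.
rewrite (_ : 3 + k = 2 * (k./2 + 2)); last by lia.
rewrite hE ?hD; [|lia..].
rewrite [V 4]V4 [V 3]V3 V2; by case: (V (_ + _)); case: (V _).
Qed.

(** The vertices [*] and 0, with exceptional vertex [w]. Antiperiodicity doubles
    the constraints, which absorbs the single failure for [0 < t < k]; an even
    [k] is then reduced to [k / 2]. *)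
Lemma no_star_twins k V w : antiperiodic (2 * k) V -> 2 < k ->
  (forall t, 0 < t < 2 * k -> 2 * t != w -> V (2 * t) = ~~ V t) ->
  (forall t, t < 2 * k -> (2 * t).+1 != w -> V (2 * t).+1 = V t) -> False.
Proof.
move=> hV k_gt2 hD hE.
have far t : V (2 * (t + k)) = ~~ V (2 * t) /\ V (2 * (t + k)).+1 = ~~ V (2 * t).+1.
  by rewrite mulnDr -addSn !hV.
have [hD' hE' hk'] : [/\ forall t, 0 < t < k -> V (2 * t) = ~~ V t,
    forall t, 0 < t < k -> V (2 * t).+1 = V t &
    forall t, 0 < t < k -> V (t + k) = ~~ V t].
  (* Any three of the constraints at [2 t], [2 t + 1], [2 (t + k)] and
     [2 (t + k) + 1] imply the fourth, and at most one of them fails. *)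
  have H t : 0 < t < k ->
      [/\ V (2 * t) = ~~ V t, V (2 * t).+1 = V t & V (t + k) = ~~ V t].
    move=> t_in; have [f1 f2] := far t.
    have D1 := hD t ltac:(lia); have D2 := hD (t + k) ltac:(lia).
    have E1 := hE t ltac:(lia); have E2 := hE (t + k) ltac:(lia).
    rewrite f1 in D2; rewrite f2 in E2.
    have [w1|/D1 {}D1] := eqVneq (2 * t) w.
      have {}D2 := D2 ltac:(lia); have {}E1 := E1 ltac:(lia).
      have {}E2 := E2 ltac:(lia).
      by move: D2 E1 E2; do 4![case: (V _)].
    have [w1|/D2 {}D2] := eqVneq (2 * (t + k)) w.
      have {}E1 := E1 ltac:(lia); have {}E2 := E2 ltac:(lia).
      by move: D1 E1 E2; do 4![case: (V _)].
    have [w1|/E1 {}E1] := eqVneq (2 * t).+1 w.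
      have {}E2 := E2 ltac:(lia).
      by move: D1 D2 E2; do 4![case: (V _)].
    by move: D1 D2 E1; do 4![case: (V _)].
  by split=> t /H[].
have [odd_k|even_k] := boolP (odd k); first exact: (@no_doubling_sequence k V).
(* For [k = 2 j] the relations descend to [j]. *)
pose j := k./2; have k_eq : k = 2 * j by rewrite /j; lia.
have Vk : V k = V 1.
  have := hE' j ltac:(lia); have := hD' j ltac:(lia).
  have := hk' 1 ltac:(lia); rewrite -k_eq add1n => -> ->.
  by case: (V 1); case: (V j).
have Vj : V j = ~~ V 1.
  by have := hD' j ltac:(lia); rewrite -k_eq Vk => ->; rewrite negbK.
have V0 : V 0 = V 1.
  have D := hD k ltac:(lia); have E := hE 0 ltac:(lia).
  have E' := hE k ltac:(lia); move: D E E'.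
  rewrite -[2 * k]add0n -[in (0 + 2 * k).+1]addSn !hV Vk muln0.
  have [w1|w1] := eqVneq 1 w; last by move=> _ ->.
  by move=> /(_ ltac:(lia)); case: (V 0); case: (V 1).
have hkj t : 0 < t < j -> V (t + j) = ~~ V t.
  move=> t_in; have := hk' (2 * t) ltac:(lia).
  by rewrite {1}k_eq -mulnDr !hD' ?negbK; [move=> <-; rewrite negbK|lia..].
have [odd_j|even_j] := boolP (odd j).
  apply: (@no_doubling_sequence j V) => //; first by lia.
    by move=> t t_in; apply: hD'; lia.
  by move=> t t_in; apply: hE'; lia.
pose i := j./2; have j_eq : j = 2 * i by rewrite /i; lia.
have := hD' i ltac:(lia); rewrite -j_eq Vj.
have := hE' i ltac:(lia); rewrite -j_eq -add1n hkj; last by lia.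
by case: (V i); case: (V 1).
Qed.

(** * Arcs of Walecki tournaments *)

(** The signature extended to all indices, so that the positive cycle at [i]
    is part of the tournament exactly when [esig v i] holds: moving the index by
    [m] reverses the cycle. *)
Definition esig (m : nat) (v : m.-tuple bool) (i : nat) : bool :=
  nth false v (i %% m) (+) odd (i %/ m).

Lemma esig_antiperiodic m (v : m.-tuple bool) :
  0 < m -> antiperiodic m (esig v).
Proof.
move=> m_gt0 t; rewrite /esig modnDr divnDr // divnn m_gt0 addn1 /=.
by rewrite addbN.
Qed.

Lemma esig_small m (v : m.-tuple bool) i : i < m -> esig v i = nth false v i.
Proof. by move=> lt_im; rewrite /esig modn_small // divn_small // addbF. Qed.

Lemma natr2m m : 0 < m -> ((2 * m)%:R = 0 :> 'Z_(2 * m))%R.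
Proof. by move=> m_gt0; rewrite pchar_Zp //; lia. Qed.

Lemma val_natr m i : 0 < m -> (i%:R%R : 'Z_(2 * m)) = i %% (2 * m) :> nat.
Proof. by move=> m_gt0; rewrite val_Zp_nat //; lia. Qed.

Lemma ltn_val m (x : 'Z_(2 * m)) : 0 < m -> x < 2 * m.
Proof.
by move=> m_gt0; have := ltn_ord x; rewrite [X in _ < X]Zp_cast //; lia.
Qed.

Lemma natr_mod m a b : 0 < m -> a = b %[mod 2 * m] ->
  (a%:R = b%:R :> 'Z_(2 * m))%R.
Proof. by move=> m_gt0 E; apply: ord_inj; rewrite !val_natr. Qed.

(** The arcs of the tournament with extended signature [V]. The difference
    [b - a] is read as its representative between 0 and [2 * m - 1]. *)
Definition walecki_rel (m : nat) (V : nat -> bool) (x y : vertex m) : bool :=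
  match x, y with
  | None, None => false
  | None, Some b => V b
  | Some a, None => ~~ V a
  | Some a, Some b =>
      (a != b) && (V (a + ((b - a)%R : nat)./2) (+) ~~ odd (b - a)%R)
  end.

Lemma walecki_rel_from_star m V b : 0 < m -> antiperiodic m V ->
  walecki_rel V (star m) (lab m b) = V b.
Proof. by move=> m_gt0 hV; rewrite /walecki_rel /star /lab val_natr // antiperiodic_mod. Qed.

Lemma walecki_rel_to_star m V b : 0 < m -> antiperiodic m V ->
  walecki_rel V (lab m b) (star m) = ~~ V b.
Proof. by move=> m_gt0 hV; rewrite /walecki_rel /star /lab val_natr // antiperiodic_mod. Qed.

Lemma lab_addn_eq m b d : 0 < m -> 0 < d < 2 * m ->
  (lab m b == lab m (b + d)) = false.
Proof.
move=> m_gt0 d_in; apply/negP => /eqP[] /(congr1 (@nat_of_ord _)).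
rewrite !val_natr // => /eqP; rewrite -{1}[b]addn0 eqn_modDl.
by rewrite mod0n modn_small; lia.
Qed.

Lemma walecki_rel_step m V b d : 0 < m -> antiperiodic m V -> 0 < d < 2 * m ->
  walecki_rel V (lab m b) (lab m (b + d)) = V (b + d./2) (+) ~~ odd d.
Proof.
move=> m_gt0 hV d_in; rewrite /walecki_rel /lab.
have := lab_addn_eq b m_gt0 d_in; rewrite /lab (inj_eq Some_inj) => ->; rewrite andTb.
rewrite natrD [(_ + d%:R)%R]addrC addrK !val_natr // [d %% _]modn_small; last by lia.
by rewrite -(antiperiodic_mod _ hV) modnDml antiperiodic_mod.
Qed.

Lemma lab_step m b c : 0 < m -> lab m b != lab m c ->
  exists2 d, 0 < d < 2 * m & lab m c = lab m (b + d).
Proof.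
move=> m_gt0 neq; exists (((c%:R - b%:R)%R : 'Z_(2 * m)) : nat).
  rewrite ltn_val // andbT lt0n; apply: contra neq => /eqP E.
  by rewrite /lab (inj_eq Some_inj) eq_sym -subr_eq0; apply/eqP/ord_inj.
by rewrite /lab natrD natr_Zp addrC subrK.
Qed.

Lemma vertexP m (x : vertex m) : x = star m \/ exists b, x = lab m b.
Proof.
by case: x => [b|]; [right; exists (b : nat); rewrite /lab natr_Zp | left].
Qed.

(** With an antiperiodic [V] the relation is a tournament. *)
Lemma walecki_rel_anti m V x y : 0 < m -> antiperiodic m V ->
  x != y -> walecki_rel (m := m) V y x = ~~ walecki_rel V x y.
Proof.
move=> m_gt0 hV.
have [->|[b ->]] := vertexP x; have [->|[c ->]] := vertexP y => // neq.
  by rewrite walecki_rel_from_star ?walecki_rel_to_star ?negbK.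
have [d d_in E] := lab_step m_gt0 neq; have lt_d : d <= 2 * m by lia.
rewrite E; have E' : lab m b = lab m ((b + d) + (2 * m - d)).
  by rewrite /lab; congr (Some _); apply: natr_mod => //; rewrite -addnA subnKC // modnDr.
rewrite {1}E' !walecki_rel_step //; last by lia.
rewrite (_ : b + d + (2 * m - d)./2 = b + d./2 + m); last by lia.
by rewrite hV oddB ?oddM; [case: (odd d); case: (V _) | lia].
Qed.

(** * The base Hamilton cycle *)

(** The vertices of the base cycle after [*], counted from 0. *)
Definition zigzag (m p : nat) : 'Z_(2 * m) :=
  (if odd p then (uphalf p)%:R else - (p./2)%:R)%R.

Lemma zigzag_even m i : zigzag m (2 * i) = (- i%:R)%R.
Proof. by rewrite /zigzag (mul2n i) odd_double doubleK. Qed.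

Lemma zigzag_odd m i : zigzag m (2 * i).+1 = (i.+1%:R)%R.
Proof.
have odd_i : odd (2 * i).+1 by lia.
by rewrite /zigzag odd_i; congr (_%:R)%R; lia.
Qed.

Lemma hamilton0E m : 0 < m ->
  hamilton0 m = star m :: [seq Some (zigzag m p) | p <- iota 0 (2 * m)].
Proof.
have flat a r :
    flatten [seq [:: Some i%:R; Some (- i%:R)] | i <- iota a.+1 r]%R =
    [seq Some (zigzag m p) | p <- iota (2 * a).+1 (2 * r)].
  elim: r a => [|r IH] a; first by rewrite muln0.
  rewrite (_ : 2 * r.+1 = (2 * r).+2) ?mulnS //= {}IH.
  have E : (2 * a).+2 = 2 * a.+1 by lia.
  by rewrite zigzag_odd E zigzag_even.
case: m flat => // m flat _; rewrite /hamilton0 (flat 0).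
have -> : iota 0 (2 * m.+1) = 0 :: iota 1 (2 * m) ++ [:: (2 * m).+1].
  rewrite (_ : 2 * m.+1 = (2 * m + 1).+1) /=; last by lia.
  by rewrite iotaD add1n.
by rewrite map_cons map_cat [zigzag _ 0](zigzag_even _ 0) oppr0 /= zigzag_odd muln0.
Qed.

(** * Arcs of the shifted cycles *)

Lemma next_nth_cyclic (T : eqType) (x0 : T) s i : uniq s -> i < size s ->
  next s (nth x0 s i) = nth x0 s (i.+1 %% size s).
Proof.
case: s => // y s s_uniq lt_i; rewrite next_nth mem_nth // index_uniq //=.
have [i_max|i_neq] := eqVneq i (size s).
  by rewrite i_max modnn nth_default.
have lt_is : i < size s by move: lt_i => /=; lia.
by rewrite modn_small //; exact: set_nth_default.
Qed.

Lemma cycle_arcsP (T : finType) (x0 : T) s x y : uniq s ->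
  reflect (exists2 i, i < size s &
             x = nth x0 s i /\ y = nth x0 s (i.+1 %% size s))
          ((x, y) \in cycle_arcs s).
Proof.
move=> s_uniq; apply: (iffP imsetP) => [[z z_in [-> ->]]|[i lt_i [-> ->]]].
  exists (index z s); rewrite ?index_mem // -next_nth_cyclic ?index_mem //.
  by rewrite nth_index.
by exists (nth x0 s i); rewrite ?mem_nth ?next_nth_cyclic.
Qed.

(** The vertices of the cycle shifted by [j], in order, starting at [*]. *)
Definition node (m : nat) (j : 'Z_(2 * m)) (p : nat) : vertex m :=
  if p is q.+1 then Some (zigzag m q + j)%R else star m.

Lemma shifted_hamiltonE m (j : 'Z_(2 * m)) : 0 < m ->
  [seq shift j x | x <- hamilton0 m] = [seq node j p | p <- iota 0 (2 * m).+1].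
Proof.
move=> m_gt0; rewrite hamilton0E //= -map_comp; congr (_ :: _).
by rewrite (iotaDl 1 0) -map_comp.
Qed.

Lemma zigzag_inj m p q : 0 < m -> p < 2 * m -> q < 2 * m ->
  zigzag m p = zigzag m q -> p = q.
Proof.
move=> m_gt0.
have val_zigzag r : r < 2 * m ->
    (zigzag m r : nat) = if odd r then uphalf r else (2 * m - r./2) %% (2 * m).
  move=> lt_r; rewrite /zigzag; case: ifP => odd_r.
    by rewrite val_natr // modn_small //; lia.
  have -> : (- r./2%:R = (2 * m - r./2)%:R :> 'Z_(2 * m))%R.
    by rewrite natrB ?natr2m ?sub0r //; lia.
  by rewrite val_natr.
move=> lt_p lt_q /(congr1 (@nat_of_ord _)); rewrite !val_zigzag //.
case: (posnP p) => [->|p0]; case: (posnP q) => [->|q0] //=; rewrite ?subn0 ?modnn.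
- case: ifP => odd_q; first by lia.
  by rewrite modn_small; lia.
- case: ifP => odd_p; first by lia.
  by rewrite modn_small; lia.
by case: ifP => odd_p; case: ifP => odd_q; rewrite ?modn_small; lia.
Qed.

Lemma uniq_node m (j : 'Z_(2 * m)) : 0 < m ->
  uniq [seq node j p | p <- iota 0 (2 * m).+1].
Proof.
move=> m_gt0; rewrite map_inj_in_uniq ?iota_uniq // => p q.
rewrite !mem_iota !add0n; case: p q => [|p] [|q] // lt_p lt_q.
by rewrite /node => /Some_inj/addIr/(zigzag_inj m_gt0 lt_p lt_q) ->.
Qed.

Lemma hamilton_posP m (j : 'Z_(2 * m)) x y : 0 < m ->
  reflect (exists2 p, p < (2 * m).+1 &
             x = node j p /\ y = node j (p.+1 %% (2 * m).+1))
          ((x, y) \in hamilton_pos j).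
Proof.
move=> m_gt0; rewrite /hamilton_pos shifted_hamiltonE //.
apply: (iffP (cycle_arcsP (star m) _ _ (uniq_node j m_gt0))).
  rewrite size_map size_iota => -[p lt_p [-> ->]]; exists p => //.
  by rewrite !(nth_map 0) ?size_iota ?nth_iota ?ltn_pmod.
rewrite size_map size_iota => -[p lt_p [-> ->]]; exists p => //.
by rewrite !(nth_map 0) ?size_iota ?nth_iota ?ltn_pmod.
Qed.

Lemma reverseE (T : finType) (A : digraph T) x y :
  ((x, y) \in reverse A) = ((y, x) \in A).
Proof.
apply/imsetP/idP => [[[a b] ab [-> ->]] //|yx].
by exists (y, x).
Qed.

(** All arcs of the positive cycle at [j] have the orientation prescribed by
    the bit [V j]. *)
Lemma walecki_rel_hamilton m V j x y : 0 < m -> antiperiodic m V ->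
  (x, y) \in hamilton_pos (j%:R : 'Z_(2 * m))%R -> walecki_rel V x y = V j.
Proof.
move=> m_gt0 hV /hamilton_posP -/(_ m_gt0) [p lt_p [-> ->]] {x y}.
have [p_eq|p_neq] := eqVneq p (2 * m).
  rewrite {2}p_eq modnn (_ : p = (2 * m.-1).+2); last by lia.
  rewrite /node zigzag_odd -natrD (_ : m.-1.+1 + j = j + m); last by lia.
  by rewrite (walecki_rel_to_star _ m_gt0 hV) hV negbK.
rewrite modn_small; last by lia.
case: p => [|p] in lt_p p_neq *.
  rewrite /node [zigzag _ 0](zigzag_even _ 0) oppr0 add0r.
  by rewrite (walecki_rel_from_star _ m_gt0 hV).
have p_eq := odd_double_half p; set i := p./2 in p_eq.
rewrite /node -p_eq -mul2n; case: (odd p) p_eq => p_eq.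
  rewrite !add1n zigzag_odd -[(2 * i).+2](mulnS 2) zigzag_even.
  have -> : (- i.+1%:R + j%:R = (i.+1 + j + (2 * m - 2 * i.+1))%:R :> 'Z_(2 * m))%R.
    by rewrite !natrD natrB ?natr2m //; [ring | lia].
  rewrite -natrD (walecki_rel_step _ m_gt0 hV); last by lia.
  rewrite -mulnBr mul2n odd_double doubleK addbT.
  by rewrite (_ : _ + _ = j + m) ?hV ?negbK //; lia.
rewrite !add0n zigzag_odd zigzag_even.
have -> : (- i%:R + j%:R = (2 * m - i + j)%:R :> 'Z_(2 * m))%R.
  by rewrite natrD natrB ?natr2m ?sub0r //; lia.
have -> : (i.+1%:R + j%:R = (2 * m - i + j + (2 * i).+1)%:R :> 'Z_(2 * m))%R.
  rewrite !natrD natrB ?natr2m ?sub0r //; last by lia.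
  by rewrite -(natr1 i) -(natr1 (2 * i)) natrM; ring.
rewrite (walecki_rel_step _ m_gt0 hV); last by lia.
rewrite /= (mul2n i) odd_double addbF uphalf_double.
by rewrite (_ : _ + _ = j + 2 * m) ?antiperiodic_add2m //; lia.
Qed.

Lemma hamilton_pos_node m (j : 'Z_(2 * m)) p : 0 < m -> p < 2 * m ->
  (node j p, node j p.+1) \in hamilton_pos j.
Proof.
move=> m_gt0 lt_p; apply/(hamilton_posP _ _ _ m_gt0).
by exists p; rewrite ?modn_small // ltnW.
Qed.

Lemma hamilton_pos_first m (j : 'Z_(2 * m)) : 0 < m ->
  (star m, Some j) \in hamilton_pos j.
Proof.
move=> m_gt0; have := @hamilton_pos_node m j 0 m_gt0.
by rewrite /node [zigzag _ 0](zigzag_even _ 0) oppr0 add0r; apply; lia.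
Qed.

Lemma hamilton_pos_last m (j : 'Z_(2 * m)) : 0 < m ->
  (Some (j + m%:R)%R, star m) \in hamilton_pos j.
Proof.
move=> m_gt0; apply/(hamilton_posP _ _ _ m_gt0); exists (2 * m) => //.
have last_node q : q = (2 * m.-1).+2 -> node j q = Some (j + m%:R)%R.
  by move=> ->; rewrite /node zigzag_odd prednK // addrC.
by rewrite modnn last_node //; lia.
Qed.

(** The arcs of the cycle at [j] join vertices of sum [2 j + 1] or [2 j]. *)
Lemma hamilton_pos_sum1 m (j : 'Z_(2 * m)) i : i < m ->
  (Some (j - i%:R)%R, Some (j + i.+1%:R)%R) \in hamilton_pos j.
Proof.
move=> lt_i; have := @hamilton_pos_node m j (2 * i).+1.
rewrite /node zigzag_even zigzag_odd addrC [(_ + j)%R in X in (_, X)]addrC.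
by apply; lia.
Qed.

Lemma hamilton_pos_sum0 m (j : 'Z_(2 * m)) i : 0 < i < m ->
  (Some (j + i%:R)%R, Some (j - i%:R)%R) \in hamilton_pos j.
Proof.
move=> i_in; have := @hamilton_pos_node m j (2 * i.-1).+2.
have E : (2 * i.-1).+2 = 2 * i by lia.
rewrite /node zigzag_odd E zigzag_even prednK; last by lia.
by rewrite addrC [(_ + j)%R in X in (_, X)]addrC; apply; lia.
Qed.

(** The cycles at [0], ..., [m - 1] cover all pairs of distinct vertices. *)
Lemma hamilton_pos_total m x y : 0 < m -> x != y :> vertex m ->
  exists2 j, j < m & ((x, y) \in hamilton_pos (j%:R : 'Z_(2 * m))%R) \/
                     ((y, x) \in hamilton_pos (j%:R : 'Z_(2 * m))%R).
Proof.
move=> m_gt0.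
have mm : (m%:R + m%:R = 0 :> 'Z_(2 * m))%R.
  by rewrite -natrD addnn -mul2n natr2m.
have red J : exists2 j, j < m &
    (J%:R = j%:R :> 'Z_(2 * m) \/ J%:R = j%:R + m%:R :> 'Z_(2 * m))%R.
  exists (J %% m); rewrite ?ltn_pmod //.
  have := divn_eq J m; move: (J %/ m) (J %% m) => q j ->.
  have -> : q * m + j = odd q * m + j + 2 * m * q./2.
    by rewrite -{1}[q]odd_double_half -mul2n; nia.
  rewrite !natrD [((2 * m * _)%:R)%R]natrM natr2m // mul0r addr0.
  by case: (odd q); [right | left]; rewrite ?mul1n ?mul0n; ring.
have from_star b : exists2 j, j < m &
    (star m, lab m b) \in hamilton_pos (j%:R : 'Z_(2 * m))%R \/
    (lab m b, star m) \in hamilton_pos (j%:R : 'Z_(2 * m))%R.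
  have [j lt_j [E|E]] := red b; exists j => //; rewrite /lab E.
    by left; apply: hamilton_pos_first.
  by right; apply: hamilton_pos_last.
have [->|[b ->]] := vertexP x; have [->|[c ->]] := vertexP y => // neq.
- have [j lt_j /or_comm ?] := from_star b; by exists j.
have [d d_in ->] := lab_step m_gt0 neq; rewrite /lab natrD.
have d_eq := odd_double_half d; move: d_eq d_in; set i := d./2 => d_eq d_in.
have [j lt_j red_j] := red (b + i); rewrite natrD in red_j; exists j => //.
have b_eq : ((b%:R = j%:R - i%:R :> 'Z_(2 * m)) \/
    (b%:R = j%:R - i%:R + m%:R :> 'Z_(2 * m)))%R.
  by case: red_j => E; [left | right; rewrite addrAC]; rewrite -E addrK.
rewrite -d_eq -muln2 natrD natrM; case: (odd d) d_eq => d_eq; rewrite ?mulr1n ?mulr0n ?add0r.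
  case: b_eq => ->.
    left; rewrite (_ : _ - _ + _ = j%:R + i.+1%:R)%R; last first.
      by rewrite -(natr1 i); ring.
    by apply: hamilton_pos_sum1; lia.
  right; have iE : ((m - i.+1)%:R = m%:R - i%:R - 1 :> 'Z_(2 * m))%R.
    by rewrite natrB -?(natr1 i) ?opprD ?addrA //; lia.
  have := @hamilton_pos_sum1 m (j%:R)%R (m - i.+1).
  rewrite -(natr1 (m - _)) iE.
  rewrite (_ : _ + (_ + _) = j%:R - i%:R + m%:R)%R; last by ring.
  rewrite (_ : _ - (_ - _ - _) = j%:R - i%:R + m%:R + (1 + i%:R * 2%:R))%R.
    by apply; lia.
  by rewrite -[LHS]addr0 -mm; ring.
case: b_eq => ->.
  right; rewrite (_ : _ - _ + _ = j%:R + i%:R)%R; last by ring.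
  by apply: hamilton_pos_sum0; lia.
left; have := @hamilton_pos_sum0 m (j%:R)%R (m - i).
rewrite natrB; last by lia.
rewrite (_ : _ + (_ - _) = j%:R - i%:R + m%:R)%R; last by ring.
rewrite (_ : _ - (_ - _) = j%:R - i%:R + m%:R + i%:R * 2%:R)%R.
  by apply; lia.
by rewrite -[LHS]addr0 -mm; ring.
Qed.

(** * Orientation of all pairs of vertices *)

(** The number [esig v j] decides the orientation of the whole cycle at [j], and
    every pair of distinct vertices is joined by one of the cycles. *)
Lemma waleckiE m (v : m.-tuple bool) x y : 0 < m ->
  ((x, y) \in walecki v) = walecki_rel (esig v) x y.
Proof.
move=> m_gt0; have hV := esig_antiperiodic v m_gt0.
have sound a b : (a, b) \in walecki v -> walecki_rel (esig v) a b.
  case/bigcupP => j _; have := esig_small v (ltn_ord j); rewrite -tnth_nth.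
  case: (tnth v j) => sj; first by move/(walecki_rel_hamilton m_gt0 hV); rewrite sj.
  rewrite reverseE => ba; have := walecki_rel_hamilton m_gt0 hV ba.
  have hV' : antiperiodic m (fun t => ~~ esig v t) by move=> t; rewrite hV.
  (* The complementary signature shows that [b] differs from [a]. *)
  have := walecki_rel_hamilton m_gt0 hV' ba; rewrite sj.
  have [->|neq _] := eqVneq b a; first by case: a {ba} => //= a; rewrite eqxx.
  by rewrite (walecki_rel_anti m_gt0 hV neq) => ->.
apply/idP/idP => [/sound //|xy].
have neq : x != y by apply: contraTneq xy => ->; case: y => //= a; rewrite eqxx.
have [j lt_j xy_j] := hamilton_pos_total m_gt0 neq.
suff [] : (x, y) \in walecki v \/ (y, x) \in walecki v => //.
  by move/sound; rewrite (walecki_rel_anti m_gt0 hV neq) xy.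
have in_walecki a b : (a, b) \in hamilton_pos (j%:R : 'Z_(2 * m))%R ->
    (a, b) \in walecki v \/ (b, a) \in walecki v.
  move=> ab; have := tnth_nth false v (Ordinal lt_j); case E: (tnth _ _) => _.
    by left; apply/bigcupP; exists (Ordinal lt_j); rewrite // E.
  by right; apply/bigcupP; exists (Ordinal lt_j); rewrite // E reverseE.
by case: xy_j => /in_walecki // /or_comm.
Qed.

Lemma walecki_anti m (v : m.-tuple bool) x y : 0 < m -> x != y ->
  ((y, x) \in walecki v) = ((x, y) \notin walecki v).
Proof.
by move=> m_gt0 neq; rewrite !waleckiE // walecki_rel_anti //; apply: esig_antiperiodic.
Qed.

(** * Almost twins *)

(** The vertices [x] and [y] are related in the same way to all vertices other
    than [x], [y] and the exceptional vertex [z]. Nothing is required at [z],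
    which may even be [x] or [y]. *)
Definition almost_twins (T : finType) (A : digraph T) (x y z : T) : Prop :=
  x != y /\ forall w, w != x -> w != y -> w != z ->
    ((x, w) \in A) = ((y, w) \in A).

Lemma almost_twinsC (T : finType) (A : digraph T) x y z :
  almost_twins A x y z -> almost_twins A y x z.
Proof.
by case=> neq h; split; [rewrite eq_sym | move=> w wy wx wz; rewrite h].
Qed.

Lemma almost_twins_iso (T T' : finType) (A : digraph T) (B : digraph T') f x y z :
  digraph_iso A B f -> almost_twins A x y z -> almost_twins B (f x) (f y) (f z).
Proof.
case=> -[g fK gK] hf [neq h]; have f_inj := can_inj fK.
split=> [|w]; first by rewrite (inj_eq f_inj).
rewrite -[w]gK !(inj_eq f_inj) => wx wy wz.
by rewrite !hf; apply: h.
Qed.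

Lemma digraph_iso_inv (T T' : finType) (A : digraph T) (B : digraph T') f g :
  cancel f g -> cancel g f -> digraph_iso A B f -> digraph_iso B A g.
Proof.
move=> fK gK [_ hf]; split; first by exists f.
by move=> x y; rewrite -hf !gK.
Qed.

Lemma lab_add_inj m b i j : 0 < m -> i < 2 * m -> j < 2 * m ->
  (lab m (b + i) == lab m (b + j)) = (i == j).
Proof.
move=> m_gt0 lt_i lt_j; apply/eqP/eqP => [|-> //].
move=> /Some_inj/(congr1 (@nat_of_ord _)); rewrite !val_natr // => /eqP.
by rewrite eqn_modDl !modn_small // => /eqP.
Qed.

Lemma walecki_rel_labels m V b d w : 0 < m -> antiperiodic m V ->
  w != d -> w < 2 * m -> d < 2 * m ->
  walecki_rel V (lab m (b + d)) (lab m (b + w)) =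
  if d < w then V (b + d + (w - d)./2) (+) ~~ odd (w - d)
  else V (b + w + (d - w)./2) (+) odd (d - w).
Proof.
move=> m_gt0 hV neq lt_w lt_d; case: ifP => lt_dw.
  rewrite -(walecki_rel_step _ m_gt0 hV) -?addnA ?subnKC //; lia.
rewrite (walecki_rel_anti m_gt0 hV) ?lab_add_inj //.
rewrite -{1}(subnKC (_ : w <= d)) ?addnA ?walecki_rel_step //; lia.
Qed.

(** Disagreement of two vertices at even distance on the vertex [b + w]. *)
Lemma walecki_rel_even_gap m V b e w : 0 < m -> antiperiodic m V ->
  0 < e < m -> 0 < w < 2 * m -> w != 2 * e ->
  walecki_rel V (lab m b) (lab m (b + w)) (+)
  walecki_rel V (lab m (b + 2 * e)) (lab m (b + w)) =
  V (b + w./2) (+) V (b + (w./2 + e)) (+) (w./2 < e).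
Proof.
move=> m_gt0 hV e_in w_in neq.
rewrite walecki_rel_step // walecki_rel_labels //; try lia.
case: ifP => lt_w.
  rewrite (_ : w./2 < e = false) ?oddB ?oddM; try lia.
  rewrite (_ : b + 2 * e + (w - 2 * e)./2 = b + (w./2 + e)); last by lia.
  by case: odd; do 2![case: (V _)].
rewrite (_ : w./2 < e) ?oddB ?oddM; try lia.
rewrite (_ : b + w + (2 * e - w)./2 = b + (w./2 + e)); last by lia.
by case: odd; do 2![case: (V _)].
Qed.

(** Disagreement of two vertices at odd distance on the vertex [b + w]. *)
Lemma walecki_rel_odd_gap m V b e w : 0 < m -> antiperiodic m V ->
  e < m -> 0 < w < 2 * m -> w != (2 * e).+1 ->
  walecki_rel V (lab m b) (lab m (b + w)) (+)
  walecki_rel V (lab m (b + (2 * e).+1)) (lab m (b + w)) =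
  ~~ (V (b + w./2) (+) V (b + (w./2 + e + odd w)) (+) (w./2 + odd w <= e)).
Proof.
move=> m_gt0 hV e_in w_in neq.
rewrite walecki_rel_step // walecki_rel_labels //; try lia.
have -> : (w./2 + odd w <= e) = ~~ ((2 * e).+1 < w) by lia.
case: ifP => lt_w.
  rewrite oddB /= ?oddM; try lia.
  rewrite (_ : b + (2 * e).+1 + _ = b + (w./2 + e + odd w)); last by lia.
  by case: odd; do 2![case: (V _)].
rewrite oddB /= ?oddM; try lia.
rewrite (_ : b + w + _ = b + (w./2 + e + odd w)); last by lia.
by case: odd; do 2![case: (V _)].
Qed.

(** * Almost twins in Walecki tournaments *)

Lemma lab_step0 m b c : 0 < m ->
  exists2 w, w < 2 * m & lab m c = lab m (b + w).
Proof.
move=> m_gt0; have [->|neq] := eqVneq (lab m c) (lab m b).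
  by exists 0; rewrite ?addn0 //; lia.
by rewrite eq_sym in neq; have [d] := lab_step m_gt0 neq; exists d => //; lia.
Qed.

Lemma star_not_almost_twin k (v : (2 * k).-tuple bool) y z : 2 < k ->
  ~ almost_twins (walecki v) (star (2 * k)) y z.
Proof.
move=> k_gt2; have m_gt0 : 0 < 2 * k by lia.
have hV := esig_antiperiodic v m_gt0.
have [->|[b ->]] := vertexP y; first by case; rewrite eqxx.
case=> _ h.
have [w lt_w hw] : exists2 w, w < 2 * (2 * k) &
    forall i, i < 2 * (2 * k) -> i != w -> lab (2 * k) (b + i) != z.
  have [->|[c ->]] := vertexP z; first by exists 0; rewrite //; lia.
  have [w lt_w ->] := lab_step0 b c m_gt0; exists w => // i lt_i neq.
  by rewrite lab_add_inj.
have agree i : 0 < i < 2 * (2 * k) -> i != w ->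
    esig v (b + i) = esig v (b + i./2) (+) ~~ odd i.
  move=> i_in neq; have := h (lab _ (b + i)).
  rewrite !waleckiE // walecki_rel_step // walecki_rel_from_star //; apply => //.
    by rewrite eq_sym lab_addn_eq.
  by apply: hw => //; lia.
apply: (@no_star_twins k (fun t => esig v (b + t)) w) => //.
- exact: antiperiodic_shift.
- move=> t t_in neq; rewrite agree //; last by lia.
  by rewrite oddM /= addbT (mul2n t) doubleK.
move=> t t_in neq; rewrite agree //; last by lia.
by rewrite /= oddM /= addbF (mul2n t) uphalf_double.
Qed.

(** Almost twins other than [*] whose exceptional vertex is not [*] only occur
    when the signature shifted by [b] is constant. Requiring [d <= 2 * k] is no
    restriction, since almost twins can be exchanged. *)
Lemma almost_twins_labels k (v : (2 * k).-tuple bool) b d c : 1 < k ->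
  0 < d <= 2 * k ->
  almost_twins (walecki v) (lab (2 * k) b) (lab (2 * k) (b + d)) (lab (2 * k) c) ->
  [/\ d = (2 * k).-1, lab (2 * k) c = lab (2 * k) (b + 2 * k) &
      forall t, t < 2 * k -> esig v (b + t) = esig v b].
Proof.
move=> k_gt1 d_in [neq h]; have m_gt0 : 0 < 2 * k by lia.
have hV := esig_antiperiodic v m_gt0; have hVb := antiperiodic_shift b hV.
have [w lt_w E] := lab_step0 b c m_gt0; rewrite {}E in h *.
have V0 : esig v b = esig v (b + d).
  have := h (star _) isT isT isT; rewrite !waleckiE // !walecki_rel_to_star //.
  exact: (can_inj negbK).
have agree i : 0 < i < 2 * (2 * k) -> i != d -> i != w ->
    walecki_rel (esig v) (lab (2 * k) b) (lab (2 * k) (b + i)) (+)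
    walecki_rel (esig v) (lab (2 * k) (b + d)) (lab (2 * k) (b + i)) = false.
  move=> i_in id iw; rewrite -!waleckiE // h ?addbb ?lab_add_inj //; try lia.
  by rewrite eq_sym lab_addn_eq.
have d_eq := odd_double_half d; move: d_eq d_in h V0 agree {neq}.
set e := d./2 => <-; rewrite -muln2 mulnC; case: (odd d) => d_in h V0 agree.
  rewrite add1n in d_in h V0 agree *.
  have hA t : 0 < t < 2 * k -> 2 * t != w ->
      esig v (b + t) (+) esig v (b + (t + e)) (+) (t <= e).
    move=> t_in tw; have := agree (2 * t) ltac:(lia) ltac:(lia) tw.
    rewrite walecki_rel_odd_gap //; try lia.
    by rewrite (mul2n t) doubleK odd_double !addn0 => /negbFE.
  have hB t : t < 2 * k -> t != e -> (2 * t).+1 != w ->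
      esig v (b + t) (+) esig v (b + (t + e).+1) (+) (t < e).
    move=> t_in te tw; have := agree (2 * t).+1 ltac:(lia) ltac:(lia) tw.
    rewrite walecki_rel_odd_gap //; try lia.
    by rewrite /= (mul2n t) uphalf_double odd_double !addn1 => /negbFE.
  have [||k_eq w_eq const] := odd_twins hVb k_gt1 _ _ hA hB.
  - by lia.
  - by rewrite addn0.
  split; [by rewrite k_eq; lia | by rewrite w_eq |].
  by move=> t /const ->; rewrite addn0.
exfalso; rewrite add0n in d_in h V0 agree.
have lt_em : 0 < e < 2 * k by lia.
apply: (no_even_twins hVb lt_em); first by rewrite addn0.
move=> t t_in te.
(* Both 2 t and 2 t + 1 test the same bits, and one of them is not [w]. *)
have [i i_in [iw i_t]] : exists2 i, 0 < i < 2 * (2 * k) & i != w /\ i./2 = t.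
  have [tw|tw] := eqVneq (2 * t) w; last by exists (2 * t); [|split]; lia.
  by exists (2 * t).+1; [|split]; lia.
have := agree i i_in _ iw; rewrite walecki_rel_even_gap ?i_t //; lia.
Qed.

Lemma constant_almost_twins k (v : (2 * k).-tuple bool) b : 0 < k ->
  (forall t, t < 2 * k -> esig v (b + t) = esig v b) ->
  almost_twins (walecki v) (lab (2 * k) b) (lab (2 * k) (b + (2 * k).-1))
    (lab (2 * k) (b + 2 * k)).
Proof.
move=> k_gt0 const; have m_gt0 : 0 < 2 * k by lia.
have hV := esig_antiperiodic v m_gt0; have hVb := antiperiodic_shift b hV.
split; first by rewrite lab_addn_eq //; lia.
move=> x xb xd xw; rewrite !waleckiE //.
have [x_eq|[c x_eq]] := vertexP x; move: xb xd xw; rewrite {}x_eq.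
  by move=> _ _ _; rewrite !walecki_rel_to_star // const //; lia.
have [i lt_i ->] := lab_step0 b c m_gt0.
move=> i_b; rewrite !lab_add_inj //; try lia.
have i0 : i != 0 by apply: contraNneq i_b => ->; rewrite addn0.
move=> id iw; apply/eqP; rewrite -negb_add.
have d_eq : (2 * k).-1 = (2 * k.-1).+1 by lia.
rewrite d_eq in id *; rewrite walecki_rel_odd_gap ?negbK //; try lia.
have hc t : t < 2 * k.-1.+1 -> esig v (b + t) = esig v (b + 0).
  by move=> lt_t; rewrite addn0 const //; lia.
have [||even_gap odd_gap] := @constant_odd_twins k.-1 _ i./2 _ hc.
- by rewrite prednK.
- by lia.
by case odd_i: (odd i); rewrite ?addn0 ?addn1; [apply: odd_gap|apply: even_gap]; lia.
Qed.

Lemma antipodal_almost_twins k (u : (2 * k).-tuple bool) : 0 < k ->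
  u \in antipodal_signatures k ->
  almost_twins (walecki u) (lab (2 * k) 0) (lab (2 * k) (2 * k)) (star (2 * k)).
Proof.
move=> k_gt0; rewrite inE => /forallP hu; have m_gt0 : 0 < 2 * k by lia.
have hV := esig_antiperiodic u m_gt0.
have -> : lab (2 * k) (2 * k) = lab (2 * k) (0 + 2 * k) by rewrite add0n.
split; first by rewrite lab_addn_eq //; lia.
move=> x x0 xm; rewrite !waleckiE //.
have [->|[c x_eq] _] := vertexP x; first by rewrite eqxx.
move: x0 xm; rewrite {}x_eq; have [i lt_i ->] := lab_step0 0 c m_gt0.
move=> i_0; rewrite !lab_add_inj //; try lia.
have i0 : i != 0 by apply: contraNneq i_0 => ->; rewrite addn0.
move=> im; apply/eqP; rewrite -negb_add; apply/negPf.
rewrite walecki_rel_even_gap //; try lia.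
have hu' t : t < k -> esig u (t + k) = ~~ esig u t.
  move=> lt_t; have : esig u (t + k) != esig u t.
    by rewrite !esig_small; [exact: (hu (Ordinal lt_t)) | lia | lia].
  by case: (esig u t); case: (esig u _).
have [lt_ik|le_ki] := ltnP i./2 k.
  by rewrite !add0n hu' //; case: (esig _ _).
rewrite !add0n addbF -(subnK le_ki) -addnA addnn -mul2n hV hu'; last by lia.
by rewrite addbb.
Qed.

(** * Isomorphisms *)

Lemma iso_fixes_star k (u v : (2 * k).-tuple bool) f : 2 < k ->
  u \in antipodal_signatures k -> digraph_iso (walecki u) (walecki v) f ->
  f (star (2 * k)) = star (2 * k).
Proof.
move=> k_gt2 hu hf; have m_gt0 : 0 < 2 * k by lia.
have [//|[c fc]] := vertexP (f (star (2 * k))); exfalso.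
have := antipodal_almost_twins (ltnW (ltnW k_gt2)) hu.
move/(almost_twins_iso hf); rewrite fc.
have [->|[b ->]] := vertexP (f (lab _ 0)); first exact: star_not_almost_twin.
have [->|[b' ->]] := vertexP (f (lab _ (2 * k))).
  by move/almost_twinsC; exact: star_not_almost_twin.
move=> tw.
have {b b' tw} [b [d [d_in tw]]] : exists b d, 0 < d <= 2 * k /\
    almost_twins (walecki v) (lab _ b) (lab _ (b + d)) (lab _ c).
  have [d d_in E] := lab_step m_gt0 (proj1 tw).
  have [le_d|lt_d] := leqP d (2 * k).
    by exists b, d; rewrite -E; split=> //; lia.
  exists b', (2 * (2 * k) - d); split; first by lia.
  have -> : lab (2 * k) (b' + (2 * (2 * k) - d)) = lab (2 * k) b.
    rewrite /lab natrD; case: E => ->; have le_d : d <= 2 * (2 * k) by lia.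
    by rewrite -natrD -addnA subnKC // natrD natr2m // addr0.
  exact: almost_twinsC.
have [_ c_eq const] := almost_twins_labels (ltnW k_gt2) d_in tw.
have hV := esig_antiperiodic v m_gt0.
have k_gt0 : 0 < k by lia.
(* The exceptional vertex [b + 2 k] is itself an almost twin. *)
have const' t : t < 2 * k -> esig v (b + 2 * k + t) = esig v (b + 2 * k).
  by move=> lt_t; rewrite addnAC !hV const.
have := constant_almost_twins k_gt0 const'.
rewrite -c_eq -fc; case: (hf) => -[g fK gK] _.
move/(almost_twins_iso (digraph_iso_inv fK gK hf)); rewrite fK.
exact: star_not_almost_twin.
Qed.

Lemma card_vertex m : 0 < m -> #|vertex m| = (2 * m).+1.
Proof. by move=> m_gt0; rewrite card_option card_ord Zp_cast //; lia. Qed.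

(** * Triangles *)

Lemma cycle_arcs_rot (T : finType) n (s : seq T) :
  uniq s -> cycle_arcs (rot n s) = cycle_arcs s.
Proof.
move=> s_uniq; apply/setP => a.
by apply/imsetP/imsetP => -[x xs ->]; exists x;
  rewrite ?next_rot // ?mem_rot // in xs *.
Qed.

Lemma triangle_degree_almost_twins (T : finType) (A : digraph T) x y z :
  (forall a b, a != b -> ((b, a) \in A) = ((a, b) \notin A)) ->
  almost_twins A x y z -> z != x -> z != y ->
  (x, y) \in A -> (y, z) \in A -> (z, x) \in A ->
  triangle_degree A (x, y) = 1.
Proof.
move=> anti [xy_neq h] zx_neq zy_neq xy yz zx.
have third w : w != x -> w != y -> (y, w) \in A -> (w, x) \in A -> w = z.
  move=> wx wy yw; rewrite anti 1?eq_sym // => /negP xw.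
  by apply/eqP/negPn/negP => wz; apply: xw; rewrite h.
have xyz_uniq : uniq [:: x; y; z].
  by rewrite /= !inE negb_or xy_neq ![_ == z]eq_sym zx_neq zy_neq.
rewrite /triangle_degree -(cards1 (cycle_arcs [:: x; y; z])); congr #|pred_of_set _|.
apply/setP => t; rewrite in_set1 inE; apply/andP/eqP => [[]|->].
  case/imsetP => -[[|p [|q [|r []]]] //= szs]; rewrite inE /ucycleb /= andbT.
  case/andP=> /and3P[pq qr rp]; rewrite !inE negb_or => /and3P[/andP[pq_n pr_n] qr_n _].
  move=> -> /imsetP[w].
  have n1 : next [:: p; q; r] p = q by rewrite /= eqxx.
  have n2 : next [:: p; q; r] q = r by rewrite /= [q == p]eq_sym (negbTE pq_n) eqxx.
  have n3 : next [:: p; q; r] r = p.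
    by rewrite /= ![r == _]eq_sym (negbTE pr_n) (negbTE qr_n) eqxx.
  rewrite /= in n1 n2 n3.
  (* Up to rotation the triangle starts with the arc from [x] to [y]. *)
  rewrite !inE => /or3P[] /eqP-> []; rewrite ?n1 ?n2 ?n3 => xE yE.
  - subst p q; by rewrite (third r) // eq_sym.
  - subst q r; rewrite (third p) //; exact: (cycle_arcs_rot 2 xyz_uniq).
  - subst r p; rewrite (third q) //; last by rewrite eq_sym.
    exact: (cycle_arcs_rot 1 xyz_uniq).
split.
  apply/imsetP; exists [tuple x; y; z] => //.
  by rewrite inE /ucycleb xyz_uniq /= xy yz zx.
apply/imsetP; exists x; rewrite ?inE ?eqxx //=.
by rewrite eqxx.
Qed.

Theorem theorem7p2 (k : nat) (hk : (3 <= k)%N) (u : (2 * k).-tuple bool)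
    (hu : u \in antipodal_signatures k) :
  [/\ exists! a : vertex (2 * k) * vertex (2 * k),
        arc_between (walecki u) (lab (2 * k) 0) (lab (2 * k) (2 * k)) a,
      forall a : vertex (2 * k) * vertex (2 * k),
        arc_between (walecki u) (lab (2 * k) 0) (lab (2 * k) (2 * k)) a ->
        triangle_degree (walecki u) a = 1%N,
      forall f : vertex (2 * k) -> vertex (2 * k),
        digraph_iso (walecki u) (walecki u) f ->
        f (star (2 * k)) = star (2 * k)
    & forall (m : nat) (v : m.-tuple bool), (0 < m)%N ->
        forall f : vertex (2 * k) -> vertex m,
        digraph_iso (walecki u) (walecki v) f ->
        f (star (2 * k)) = star m].
Proof.
have k_gt0 : 0 < k by lia.
have m_gt0 : 0 < 2 * k by lia.
have hV := esig_antiperiodic u m_gt0.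
have tw := antipodal_almost_twins k_gt0 hu.
have anti a b := @walecki_anti _ u a b m_gt0.
set x := lab (2 * k) 0 in tw *; set y := lab (2 * k) (2 * k) in tw *.
have neq : x != y := proj1 tw.
have esig_k : esig u k = ~~ esig u 0.
  move: hu; rewrite inE => /forallP/(_ (Ordinal k_gt0)) /=.
  by rewrite -!esig_small ?add0n; [case: (esig _ 0); case: (esig _ _) | lia..].
have xy : ((x, y) \in walecki u) = esig u 0.
  rewrite waleckiE // (_ : y = lab _ (0 + 2 * k)) //.
  rewrite walecki_rel_step //; last by lia.
  have half_2k : (2 * k)./2 = k by lia.
  by rewrite oddM addbT add0n half_2k esig_k negbK.
have yx : ((y, x) \in walecki u) = ~~ esig u 0 by rewrite anti // xy.
have sx : ((star _, x) \in walecki u) = esig u 0.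
  by rewrite waleckiE // walecki_rel_from_star.
have sy : ((star _, y) \in walecki u) = ~~ esig u 0.
  by rewrite waleckiE // walecki_rel_from_star // -(hV 0) add0n.
have xs : ((x, star _) \in walecki u) = ~~ esig u 0 by rewrite anti // sx.
have ys : ((y, star _) \in walecki u) = esig u 0 by rewrite anti // sy negbK.
split.
- exists (if esig u 0 then (x, y) else (y, x)).
  split; rewrite /arc_between.
    by case: ifP => s0; split; rewrite ?xy ?yx ?s0; auto.
  by move=> a [a_in [] E]; move: a_in; rewrite E ?xy ?yx; case: (esig u 0).
- move=> a [a_in [] E]; move: a_in; rewrite {}E => a_in.
    apply: (triangle_degree_almost_twins anti tw) => //; rewrite ?ys ?sx -?xy //.
  apply: (triangle_degree_almost_twins anti (almost_twinsC tw)) => //.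
    by rewrite xs -yx.
  by rewrite sy -yx.
- by move=> f; exact: iso_fixes_star.
move=> m v m'_gt0 f hf; have [f_bij _] := hf.
have := bij_eq_card f_bij; rewrite !card_vertex // => - [] m_eq.
have m_eq' : m = 2 * k by lia.
by move: v f hf {f_bij m_eq m'_gt0}; rewrite m_eq' => v f; exact: iso_fixes_star.
Qed.
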